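(* Let $X$ be a Banach space and $T\in L(X)$ be such that (1) there exists $M\in L(X)$ with $[T,[T,M]]=0$ such that for every cyclic vector $u$ of $T$ and every $v\in X$ there exist $B,C\in\mathcal{C}(T)$ with $C[T,M]\neq 0$ and $Cv=Bu$. Then $T$ is not supercyclic. If additionally (2) there is $R\in\mathcal{C}(T)$ with dense range such that $R(X)\subseteq Y$ for some Banach space $Y\in\mathcal{Y}$ embedded into $X$, then $T$ is not weakly supercyclic.
   Context: Scalars are $\mathbb{K}\in\{\mathbb{R},\mathbb{C}\}$. $L(X)$ denotes bounded linear operators on $X$; $[T,S]=TS-ST$; $\mathcal{C}(T)=\{S\in L(X):[T,S]=0\}$. A vector $u$ is cyclic for $T$ if the linear span of $\{T^nu:n\in\mathbb{Z}_+\}$ is dense in $X$. $T$ is supercyclic (resp. weakly supercyclic) if for some $x\in X$ the set $\{zT^nx:z\in\mathbb{K},n\in\mathbb{Z}_+\}$ is norm dense (resp. weakly dense) in $X$. A Banach space $Y$ embedded into $X$ is a linear subspace of $X$ with its own norm making it a Banach space and whose topology is stronger than the one inherited from $X$. $\mathcal{Y}$ is the class of Banach spaces $X$ such that for every sequence $(x_n)_{n\in\mathbb{Z}_+}$ in $X$ with $n=O(\|x_n\|)$ as $n\to\infty$, the set $\{x_n:n\in\mathbb{Z}_+\}$ is weakly closed. *)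

(* Defs.v *)
From Stdlib Require Import Reals.
Open Scope R_scope.
Set Implicit Arguments.

Record Scalars := mkScalars {
  scal_t :> Type;
  s_zero : scal_t;
  s_one : scal_t;
  s_add : scal_t -> scal_t -> scal_t;
  s_mul : scal_t -> scal_t -> scal_t;
  s_opp : scal_t -> scal_t;
  s_abs : scal_t -> R }.

Definition R_scalars : Scalars := @mkScalars R 0 1 Rplus Rmult Ropp Rabs.

Definition Cpx : Type := (R * R)%type.
Definition Cadd (z w : Cpx) : Cpx := (fst z + fst w, snd z + snd w).
Definition Cmul (z w : Cpx) : Cpx :=
  (fst z * fst w - snd z * snd w, fst z * snd w + snd z * fst w).
Definition Copp (z : Cpx) : Cpx := (- fst z, - snd z).
Definition Cabs (z : Cpx) : R := sqrt (fst z * fst z + snd z * snd z).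
Definition C_scalars : Scalars := @mkScalars Cpx (0, 0) (1, 0) Cadd Cmul Copp Cabs.

Inductive field_kind := KReal | KComplex.
Definition Kof (k : field_kind) : Scalars :=
  match k with KReal => R_scalars | KComplex => C_scalars end.

Record Banach (K : Scalars) := mkBanach {
  vc :> Type;
  vzero : vc;
  vadd : vc -> vc -> vc;
  vopp : vc -> vc;
  vscal : K -> vc -> vc;
  vnorm : vc -> R;
  vaddA : forall x y z, vadd x (vadd y z) = vadd (vadd x y) z;
  vaddC : forall x y, vadd x y = vadd y x;
  vadd0 : forall x, vadd x vzero = x;
  vaddN : forall x, vadd x (vopp x) = vzero;
  vscal1 : forall x, vscal (s_one K) x = x;
  vscalA : forall a b x, vscal a (vscal b x) = vscal (s_mul K a b) x;
  vscalDl : forall a b x, vscal (s_add K a b) x = vadd (vscal a x) (vscal b x);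
  vscalDr : forall a x y, vscal a (vadd x y) = vadd (vscal a x) (vscal a y);
  vnorm_ge0 : forall x, 0 <= vnorm x;
  vnorm_eq0 : forall x, vnorm x = 0 -> x = vzero;
  vnormZ : forall a x, vnorm (vscal a x) = s_abs K a * vnorm x;
  vnorm_triangle : forall x y, vnorm (vadd x y) <= vnorm x + vnorm y;
  vcomplete : forall u : nat -> vc,
    (forall eps, 0 < eps -> exists N, forall m n, (N <= m)%nat -> (N <= n)%nat ->
        vnorm (vadd (u m) (vopp (u n))) < eps) ->
    exists l, forall eps, 0 < eps -> exists N, forall n, (N <= n)%nat ->
        vnorm (vadd (u n) (vopp l)) < eps }.

Arguments vzero {K} b0.
Arguments vadd {K b0}.
Arguments vopp {K b0}.
Arguments vscal {K b0}.
Arguments vnorm {K b0}.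

Section Ops.
Context {K : Scalars}.

Definition vsub {X : Banach K} (x y : X) : X := vadd x (vopp y).

Definition bounded_linear {X Y : Banach K} (T : X -> Y) : Prop :=
  (forall x y, T (vadd x y) = vadd (T x) (T y)) /\
  (forall a x, T (vscal a x) = vscal a (T x)) /\
  (exists c, forall x, vnorm (T x) <= c * vnorm x).

Definition bounded_functional {X : Banach K} (f : X -> K) : Prop :=
  (forall x y, f (vadd x y) = s_add K (f x) (f y)) /\
  (forall a x, f (vscal a x) = s_mul K a (f x)) /\
  (exists c, forall x, s_abs K (f x) <= c * vnorm x).

Definition comm {X : Banach K} (T S : X -> X) : X -> X :=
  fun x => vsub (T (S x)) (S (T x)).

Definition op_zero {X : Banach K} (A : X -> X) : Prop := forall x, A x = vzero X.

Definition in_commutant {X : Banach K} (T S : X -> X) : Prop :=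
  bounded_linear S /\ forall x, T (S x) = S (T x).

Definition dense {X : Banach K} (P : X -> Prop) : Prop :=
  forall x eps, 0 < eps -> exists y, P y /\ vnorm (vsub x y) < eps.

Definition dense_range {X : Banach K} (R : X -> X) : Prop :=
  dense (fun y => exists x, y = R x).

Fixpoint lsum {X : Banach K} (v : nat -> X) (N : nat) : X :=
  match N with
  | O => v O
  | S N' => vadd (lsum v N') (v N)
  end.

Definition cyclic_vector {X : Banach K} (T : X -> X) (u : X) : Prop :=
  dense (fun y => exists (N : nat) (a : nat -> K),
           y = lsum (fun n => vscal (a n) (Nat.iter n T u)) N).

Definition proj_orbit {X : Banach K} (T : X -> X) (x : X) : X -> Prop :=
  fun y => exists (z : K) (n : nat), y = vscal z (Nat.iter n T x).

Definition supercyclic {X : Banach K} (T : X -> X) : Prop :=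
  exists x, dense (proj_orbit T x).

Definition weak_nbhd {X : Banach K} (y : X) (m : nat) (f : nat -> X -> K) (eps : R)
  (w : X) : Prop :=
  forall i, (i < m)%nat -> s_abs K (f i (vsub w y)) < eps.

Definition weak_closure_pt {X : Banach K} (P : X -> Prop) (y : X) : Prop :=
  forall (m : nat) (f : nat -> X -> K) (eps : R),
    (forall i, (i < m)%nat -> bounded_functional (f i)) -> 0 < eps ->
    exists w, P w /\ weak_nbhd y m f eps w.

Definition weakly_dense {X : Banach K} (P : X -> Prop) : Prop :=
  forall y, weak_closure_pt P y.

Definition weakly_closed {X : Banach K} (P : X -> Prop) : Prop :=
  forall y, weak_closure_pt P y -> P y.

Definition weakly_supercyclic {X : Banach K} (T : X -> X) : Prop :=
  exists x, weakly_dense (proj_orbit T x).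

Definition class_Y (Y : Banach K) : Prop :=
  forall xs : nat -> Y,
    (exists (c : R) (N : nat), forall n, (N <= n)%nat -> INR n <= c * vnorm (xs n)) ->
    weakly_closed (fun y => exists n, y = xs n).

(** Y embedded into X via j: j injective, linear, continuous (topology of Y
    stronger than the one inherited from X). *)
Definition embedding {Y X : Banach K} (j : Y -> X) : Prop :=
  bounded_linear j /\ (forall y1 y2, j y1 = j y2 -> y1 = y2).

End Ops.

(* Main.v *)
Require Import Defs.
From Stdlib Require Import Reals Lra Lia Classical ClassicalEpsilon.
From Coquelicot Require Import Complex.
From mathcomp Require boolp classical_sets.
Open Scope R_scope.

(** Let [u] be a weakly supercyclic vector of [T]; by Hahn-Banach it is cyclic. Choose
    [B] and [C] in the commutant with [C M u = B u], put [A = [T, M]], and let [g] be a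
    functional with [f = g C A] nonzero. As [A] commutes with [T],
    [T^n M - M T^n = n T^(n-1) A], so the functional [phi = g T (B - C M)] satisfies
    [phi (T^n u) = n f (T^n u)]. Hence the image under [(f, phi)] of the projective orbit
    of [u] lies in the union of the lines [phi = n f] of [K^2]; being dense in the range
    of [(f, phi)], it forces [phi = c f] for a single natural number [c]. So [f] vanishes
    on [T^n u] for [n <> c], weak density makes [X] one-dimensional, and then [A = 0]. *)

(** * Scalars *)

(** Total inverse that completes [Kof k] to a field, so that [ring] and [field] treat both kinds of
    scalars at once. *)
Definition Kinv (k : field_kind) : Kof k -> Kof k :=
  match k with KReal => Rinv | KComplex => Cinv end.

Definition ofR (k : field_kind) : R -> Kof k :=
  match k with KReal => fun r => r | KComplex => fun r => (r, 0) end.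

Lemma Kof_field (k : field_kind) :
  field_theory (s_zero (Kof k)) (s_one (Kof k)) (s_add (Kof k)) (s_mul (Kof k))
    (fun a b => s_add (Kof k) a (s_opp (Kof k) b)) (s_opp (Kof k))
    (fun a b => s_mul (Kof k) a (Kinv k b)) (Kinv k) eq.
Proof. destruct k; [exact Rfield | exact C_field_theory]. Qed.

Lemma Cabs_Cmod (z : Cpx) : Cabs z = Cmod z.
Proof. unfold Cabs, Cmod; f_equal; ring. Qed.

Lemma abs_triangle (k : field_kind) (a b : Kof k) :
  s_abs (Kof k) (s_add (Kof k) a b) <= s_abs (Kof k) a + s_abs (Kof k) b.
Proof.
  destruct k; [apply Rabs_triang |].
  simpl; rewrite !Cabs_Cmod; apply Cmod_triangle.
Qed.

Lemma abs_mul (k : field_kind) (a b : Kof k) :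
  s_abs (Kof k) (s_mul (Kof k) a b) = s_abs (Kof k) a * s_abs (Kof k) b.
Proof.
  destruct k; [apply Rabs_mult |].
  simpl; rewrite !Cabs_Cmod; apply Cmod_mult.
Qed.

Lemma abs_opp (k : field_kind) (a : Kof k) :
  s_abs (Kof k) (s_opp (Kof k) a) = s_abs (Kof k) a.
Proof.
  destruct k; [apply Rabs_Ropp |].
  simpl; rewrite !Cabs_Cmod; apply Cmod_opp.
Qed.

Lemma abs_ofR (k : field_kind) (r : R) : s_abs (Kof k) (ofR k r) = Rabs r.
Proof.
  destruct k; [reflexivity |].
  simpl; rewrite Cabs_Cmod; apply Cmod_R.
Qed.

Lemma abs_gt0 (k : field_kind) (a : Kof k) :
  a <> s_zero (Kof k) -> 0 < s_abs (Kof k) a.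
Proof.
  destruct k; intros H; [exact (Rabs_pos_lt _ H) |].
  simpl; rewrite Cabs_Cmod; exact (proj1 (Cmod_gt_0 _) H).
Qed.

Lemma abs_ge0 (k : field_kind) (a : Kof k) : 0 <= s_abs (Kof k) a.
Proof.
  destruct k; [apply Rabs_pos |].
  simpl; rewrite Cabs_Cmod; apply Cmod_ge_0.
Qed.

Lemma ofR_add (k : field_kind) (r s : R) :
  ofR k (r + s) = s_add (Kof k) (ofR k r) (ofR k s).
Proof. destruct k; [reflexivity |]. unfold ofR; simpl; unfold Cadd; simpl; f_equal; ring. Qed.

Lemma ofR_mul (k : field_kind) (r s : R) :
  ofR k (r * s) = s_mul (Kof k) (ofR k r) (ofR k s).
Proof. destruct k; [reflexivity |]. unfold ofR; simpl; unfold Cmul; simpl; f_equal; ring. Qed.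

Lemma ofR0 (k : field_kind) : ofR k 0 = s_zero (Kof k).
Proof. destruct k; reflexivity. Qed.

Lemma ofR1 (k : field_kind) : ofR k 1 = s_one (Kof k).
Proof. destruct k; reflexivity. Qed.

Lemma ofR_inj (k : field_kind) (r s : R) : ofR k r = ofR k s -> r = s.
Proof. destruct k; [trivial |]. simpl; congruence. Qed.

(* In the complex case [f x = q x - i q (i x)]. *)
Lemma scalar_extension (k : field_kind) (X : Banach (Kof k)) (q : X -> R) :
  (forall x y, q (vadd x y) = q x + q y) ->
  (forall t x, q (vscal (ofR k t) x) = t * q x) ->
  (forall x, Rabs (q x) <= vnorm x) ->
  exists f : X -> Kof k, bounded_functional f /\
    (forall x, f x = s_zero (Kof k) -> q x = 0) /\
    (forall x, (forall a, q (vscal a x) = 0) -> f x = s_zero (Kof k)).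
Proof.
  destruct k; intros Hadd Hscal Hle.
  - exists q; split; [|split]; [split; [|split] | |].
    + exact Hadd.
    + exact Hscal.
    + exists 1; intros x; simpl; rewrite Rmult_1_l; apply Hle.
    + trivial.
    + intros x Hx; rewrite <- (vscal1 _ x); exact (Hx 1).
  - assert (Hc : forall a b x, q (vscal ((a, b) : C_scalars) x)
                  = a * q x + b * q (vscal ((0, 1) : C_scalars) x)).
    { intros a b x; rewrite <- !Hscal, <- Hadd, vscalA, <- vscalDl; simpl.
      do 2 f_equal; unfold Cadd, Cmul; simpl; f_equal; ring. }
    exists (fun x => (q x, - q (vscal ((0, 1) : C_scalars) x)) : C_scalars).
    split; [|split]; [split; [|split] | |].
    + intros x y; rewrite vscalDr, !Hadd; simpl; unfold Cadd; simpl; f_equal; ring.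
    + intros [a b] x; rewrite vscalA; simpl; unfold Cmul; simpl.
      rewrite (Hc a b), (Hc (0 * a - 1 * b) (0 * b + 1 * a)).
      f_equal; ring.
    (* The modulus is at most [sqrt 2] times the larger coordinate, and both coordinates are bounded
       by [vnorm x]. *)
    + exists 2; intros x; simpl; rewrite Cabs_Cmod.
      assert (H1 := Hle x); assert (H2 := Hle (vscal ((0, 1) : C_scalars) x)).
      rewrite vnormZ in H2; simpl in H2; unfold Cabs in H2; simpl in H2.
      replace (0 * 0 + 1 * 1) with 1 in H2 by ring; rewrite sqrt_1 in H2.
      rewrite <- Rabs_Ropp, Rmult_1_l in H2.
      assert (H3 := Cmod_2Rmax (q x, - q (vscal ((0, 1) : C_scalars) x))); simpl in H3.
      assert (Rmax (Rabs (q x)) (Rabs (- q (vscal ((0, 1) : C_scalars) x))) <= vnorm x)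
        by (apply Rmax_lub; assumption).
      assert (sqrt 2 <= 2).
      { rewrite <- (sqrt_pow2 2) at 2 by lra; apply sqrt_le_1_alt; lra. }
      assert (H6 := vnorm_ge0 _ x); assert (H7 := sqrt_pos 2).
      eapply Rle_trans; [exact H3 |].
      apply Rmult_le_compat; try assumption.
      eapply Rle_trans; [apply Rabs_pos | apply Rmax_l].
    + intros x E; injection E; trivial.
    + intros x Hx; apply (f_equal2 pair).
      * rewrite <- (vscal1 _ x); apply Hx.
      * rewrite <- Ropp_0; apply f_equal, Hx.
Qed.

Section Theory.
Context {k : field_kind}.
Local Notation K := (Kof k).
Local Notation "0k" := (s_zero (Kof k)).
Local Notation "1k" := (s_one (Kof k)).
Local Notation "a +k b" := (s_add (Kof k) a b) (at level 50, left associativity).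
Local Notation "a *k b" := (s_mul (Kof k) a b) (at level 40, left associativity).
Local Notation "-k a" := (s_opp (Kof k) a) (at level 35, right associativity).
Local Notation "`| a |" := (s_abs (Kof k) a) (at level 0, a at level 99).
Local Notation "x +v y" := (vadd x y) (at level 50, left associativity).
Local Notation "a *v x" := (vscal a x) (at level 40, left associativity).
Local Notation natK n := (ofR k (INR n)).

Add Field K_field : (Kof_field k).

(* [nat] is a closed subset of [K], here in a homogeneous form that avoids the quotient [b / a]. *)
Lemma nat_multiples_separated (a b : K) :
  a <> 0k -> (forall n, b <> natK n *k a) ->
  exists d, 0 < d /\ forall n, d * (1 + INR n) <= `|b +k -k (natK n *k a)|.
Proof.
  intros Ha Hb.
  assert (Ha' := abs_gt0 k a Ha).
  (* The weight [1 + INR n] is the size of the error in [b - n a] when [a] and [b] are both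
     perturbed by one unit. *)
  assert (Hfin : forall N, exists d, 0 < d /\ forall n, (n < N)%nat ->
            d * (1 + INR n) <= `|b +k -k (natK n *k a)|).
  { induction N as [|N [d [Hd IH]]].
    - exists 1; split; [lra | lia].
    - assert (HN : 0 < `|b +k -k (natK N *k a)|).
      { apply abs_gt0; intros E; apply (Hb N).
        replace b with ((b +k -k (natK N *k a)) +k natK N *k a) by ring.
        rewrite E; ring. }
      assert (H1 := pos_INR N).
      set (h := `|b +k -k (natK N *k a)|) in *.
      exists (Rmin d (h / (1 + INR N))); split.
      + apply Rmin_pos; [lra | apply Rdiv_lt_0_compat; lra].
      + intros n Hn; assert (Hn0 := pos_INR n).
        destruct (Nat.eq_dec n N) as [->|Hne].
        * fold h.
          apply Rle_trans with (h / (1 + INR N) * (1 + INR N)).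
          -- apply Rmult_le_compat_r; [lra | apply Rmin_r].
          -- right; field; lra.
        * apply Rle_trans with (d * (1 + INR n)).
          -- apply Rmult_le_compat_r; [lra | apply Rmin_l].
          -- apply IH; lia. }
  (* From this [N] on, [3 n |a| >= 4 |b| + |a|], which amounts to
     [n |a| - |b| >= (1 + n) |a| / 4]. *)
  destruct (INR_unbounded ((4 * `|b| / `|a| + 1) / 3)) as [N HN].
  destruct (Hfin N) as [d [Hd Hlow]].
  exists (Rmin d (`|a| / 4)); split; [apply Rmin_pos; lra |].
  intros n; assert (Hn0 := pos_INR n).
  destruct (Nat.lt_ge_cases n N) as [Hn|Hn].
  - apply Rle_trans with (d * (1 + INR n)); [| auto].
    apply Rmult_le_compat_r; [lra | apply Rmin_l].
  - apply Rle_trans with (`|a| / 4 * (1 + INR n)).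
    { apply Rmult_le_compat_r; [lra | apply Rmin_r]. }
    apply le_INR in Hn.
    assert (Ht : INR n * `|a| <= `|b +k -k (natK n *k a)| + `|b|).
    { replace (INR n * `|a|) with (`|natK n *k a|)
        by (rewrite abs_mul, abs_ofR, Rabs_pos_eq by lra; reflexivity).
      replace (natK n *k a) with (-k (b +k -k (natK n *k a)) +k b) at 1 by ring.
      eapply Rle_trans; [apply abs_triangle | rewrite abs_opp; lra]. }
    assert (H3 : (4 * `|b| / `|a| + 1) * `|a| = 4 * `|b| + `|a|) by (field; lra).
    assert (H4 : (4 * `|b| / `|a| + 1) * `|a| <= 3 * INR n * `|a|)
      by (apply Rmult_le_compat_r; lra).
    lra.
Qed.

(** * Vector arithmetic, bounded functionals and weak density *)

Section Space.
Context {X : Banach K}.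

Lemma vaddACA (a b c d : X) : (a +v b) +v (c +v d) = (a +v c) +v (b +v d).
Proof. rewrite !vaddA; f_equal; rewrite <- !vaddA; f_equal; apply vaddC. Qed.

Lemma vadd_cancel (x y z : X) : x +v z = y +v z -> x = y.
Proof.
  intros H; rewrite <- (vadd0 _ x), <- (vadd0 _ y), <- (vaddN _ z), !vaddA, H.
  reflexivity.
Qed.

Lemma vscal0 (x : X) : 0k *v x = vzero X.
Proof.
  apply vadd_cancel with (0k *v x).
  rewrite <- vscalDl, (vaddC _ (vzero X)), vadd0; f_equal; ring.
Qed.

Lemma vopp_scal (x : X) : vopp x = (-k 1k) *v x.
Proof.
  apply vadd_cancel with x; rewrite vaddC, vaddN.
  rewrite <- (vscal1 _ x) at 2; rewrite <- vscalDl, <- (vscal0 x); f_equal; ring.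
Qed.

Lemma vsub_add (x y : X) : vsub x y +v y = x.
Proof.
  unfold vsub; rewrite <- vaddA, (vaddC _ (vopp y)), vaddN; apply vadd0.
Qed.

Lemma vsubK_eq (x y : X) : vsub x y = vzero X -> x = y.
Proof. intros H; rewrite <- (vsub_add x y), H, vaddC; apply vadd0. Qed.

Lemma vnorm0 : vnorm (vzero X) = 0.
Proof.
  rewrite <- (vscal0 (vzero X)), vnormZ, <- ofR0, abs_ofR, Rabs_R0; ring.
Qed.

Lemma vnorm_opp (x : X) : vnorm (vopp x) = vnorm x.
Proof.
  rewrite vopp_scal, vnormZ, abs_opp, <- ofR1, abs_ofR, Rabs_R1; ring.
Qed.

Lemma bounded_functional_sub (f : X -> K) (x y : X) :
  bounded_functional f -> f (vsub x y) = f x +k -k f y.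
Proof.
  intros [Hadd [Hscal _]]; unfold vsub; rewrite Hadd, vopp_scal, Hscal; ring.
Qed.

Lemma bounded_functional_comb (f g : X -> K) (c : K) :
  bounded_functional f -> bounded_functional g ->
  bounded_functional (fun x => f x +k c *k g x).
Proof.
  intros [f1 [f2 [cf f3]]] [g1 [g2 [cg g3]]]; split; [|split].
  - intros x y; rewrite f1, g1; ring.
  - intros a x; rewrite f2, g2; ring.
  - exists (cf + `|c| * cg); intros x.
    eapply Rle_trans; [apply abs_triangle |]; rewrite abs_mul, Rmult_plus_distr_r.
    apply Rplus_le_compat; [apply f3 |]; rewrite Rmult_assoc.
    apply Rmult_le_compat_l; [apply abs_ge0 | apply g3].
Qed.

Lemma bounded_functional_comp (f : X -> K) (S : X -> X) :
  bounded_functional f -> bounded_linear S -> bounded_functional (fun x => f (S x)).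
Proof.
  intros [f1 [f2 [cf f3]]] [S1 [S2 [cS S3]]]; split; [|split].
  - intros x y; rewrite S1; apply f1.
  - intros a x; rewrite S2; apply f2.
  - exists (Rabs cf * cS); intros x.
    eapply Rle_trans; [apply f3 |]; rewrite Rmult_assoc.
    apply Rle_trans with (Rabs cf * vnorm (S x)).
    + apply Rmult_le_compat_r; [apply vnorm_ge0 | apply Rle_abs].
    + apply Rmult_le_compat_l; [apply Rabs_pos | apply S3].
Qed.

(** A weak neighbourhood involves finitely many bounded functionals, so it contains a norm ball; the
    radius is built by induction on their number. *)
Lemma dense_weakly_dense (P : X -> Prop) : dense P -> weakly_dense P.
Proof.
  intros HP y m f eps Hf Heps.
  assert (Hd : exists d, 0 < d /\ forall x : X, vnorm x < d ->
            forall i, (i < m)%nat -> `|f i x| < eps).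
  { induction m as [|m IH].
    - exists 1; split; [lra | lia].
    - destruct IH as [d [Hd H]]; [intros; apply Hf; lia |].
      destruct (Hf m (Nat.lt_succ_diag_r m)) as [_ [_ [c Hc]]].
      assert (Hc0 := Rabs_pos c).
      exists (Rmin d (eps / (Rabs c + 1))); split.
      + apply Rmin_pos; [lra | apply Rdiv_lt_0_compat; lra].
      + intros x Hx i Hi.
        destruct (Nat.eq_dec i m) as [->|Hne].
        * assert (Hx2 : vnorm x < eps / (Rabs c + 1))
            by (eapply Rlt_le_trans; [exact Hx | apply Rmin_r]).
          apply (Rmult_lt_compat_r (Rabs c + 1)) in Hx2; [| lra].
          replace (eps / (Rabs c + 1) * (Rabs c + 1)) with eps in Hx2 by (field; lra).
          assert (H1 := Hc x); assert (H2 := vnorm_ge0 _ x).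
          assert (H3 := Rmult_le_compat_r _ _ _ H2 (Rle_abs c)); lra.
        * apply H; [eapply Rlt_le_trans; [exact Hx | apply Rmin_l] | lia]. }
  destruct Hd as [d [Hd H]].
  destruct (HP y d Hd) as [w [Hw Hwy]].
  exists w; split; [exact Hw |]; intros i Hi.
  assert (E := H _ Hwy i Hi).
  rewrite bounded_functional_sub in E |- * by auto.
  rewrite <- abs_opp; replace (-k (f i w +k -k f i y)) with (f i y +k -k f i w) by ring.
  exact E.
Qed.

Lemma weakly_dense_pair (P : X -> Prop) (f g : X -> K) (x : X) (eps : R) :
  weakly_dense P -> bounded_functional f -> bounded_functional g -> 0 < eps ->
  exists w, P w /\ `|f w +k -k f x| < eps /\ `|g w +k -k g x| < eps.
Proof.
  intros HP Hf Hg Heps.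
  destruct (HP x 2%nat (fun i => match i with O => f | _ => g end) eps) as [w [Hw Hn]].
  - intros [|i] _; assumption.
  - assumption.
  - exists w; split; [exact Hw |].
    assert (H0 := Hn 0%nat ltac:(lia)); assert (H1 := Hn 1%nat ltac:(lia)).
    cbv beta iota in H0, H1; rewrite bounded_functional_sub in H0, H1 by assumption.
    split; assumption.
Qed.

(* The values of [(f, phi)] form a linear subspace of [K^2] contained in the closed
   set made of the lines [phi = n f], [n] natural, and of the line [f = 0]. *)
Lemma weakly_dense_natural_ratio (P : X -> Prop) (f phi : X -> K) :
  weakly_dense P -> bounded_functional f -> bounded_functional phi ->
  (forall w, P w -> exists n, phi w = natK n *k f w) ->
  exists c, forall x, phi x = natK c *k f x.
Proof.
  intros HP Hf Hphi Hw.
  assert (Hray : forall x, f x <> 0k -> exists n, phi x = natK n *k f x).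
  { intros x Hx; apply NNPP; intros Hn.
    destruct (nat_multiples_separated (f x) (phi x) Hx) as [d [Hd Hsep]].
    { intros n E; apply Hn; exists n; exact E. }
    destruct (weakly_dense_pair P f phi x d HP Hf Hphi Hd) as [w [HPw [H1 H2]]].
    destruct (Hw w HPw) as [n En].
    (* The errors below [d] in [f] and [phi] add up to less than [d * (1 + INR n)], against the
       separation. *)
    apply (Rlt_irrefl (d * (1 + INR n))).
    eapply Rle_lt_trans; [apply Hsep |].
    replace (phi x +k -k (natK n *k f x))
      with (-k (phi w +k -k phi x) +k natK n *k (f w +k -k f x))
      by (rewrite En; ring).
    eapply Rle_lt_trans; [apply abs_triangle |].
    rewrite abs_opp, abs_mul, abs_ofR, Rabs_pos_eq by apply pos_INR.
    assert (H3 := Rmult_le_compat_l _ _ _ (pos_INR n) (Rlt_le _ _ H1)); lra. }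
  destruct (classic (exists e, f e <> 0k)) as [[e He]|Hf0].
  (* If [f] is zero, then [phi] vanishes on [P], hence everywhere by density, and any [c] serves. *)
  2: { assert (Hf0' : forall x, f x = 0k)
         by (intros x; apply NNPP; intros H; apply Hf0; exists x; exact H).
       exists 0%nat; intros x.
       apply NNPP; intros Hx.
       replace (natK 0 *k f x) with 0k in Hx by (rewrite Hf0'; ring).
       destruct (weakly_dense_pair P f phi x _ HP Hf Hphi (abs_gt0 k _ Hx))
         as [w [HPw [_ H2]]].
       destruct (Hw w HPw) as [n En].
       rewrite En, Hf0' in H2.
       replace (natK n *k 0k +k -k phi x) with (-k phi x) in H2 by ring.
       rewrite abs_opp in H2; lra. }
  destruct (Hray e He) as [c Hc].
  destruct Hf as [f1 [f2 f3]]; destruct Hphi as [p1 [p2 p3]].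
  assert (Hker : forall h, f h = 0k -> phi h = 0k).
  { intros h Hh; apply NNPP; intros Hp.
    (* A kernel vector with [phi h <> 0] can shift the ratio at [e] by any amount; this [t] shifts
       it to [c + 1/2], which is not natural. *)
    set (t := ofR k (1 / 2) *k f e *k Kinv k (phi h)).
    assert (Et : f (e +v t *v h) = f e) by (rewrite f1, f2, Hh; ring).
    destruct (Hray (e +v t *v h)) as [n Hn]; [rewrite Et; exact He |].
    rewrite Et, p1, p2, Hc in Hn.
    replace (t *k phi h) with (ofR k (1 / 2) *k f e) in Hn
      by (unfold t; field; exact Hp).
    assert (E : ofR k (INR c + 1 / 2) = natK n).
    { rewrite ofR_add.
      replace (natK n) with (natK n *k f e *k Kinv k (f e)) by (field; exact He).
      rewrite <- Hn; field; exact He. }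
    apply ofR_inj in E.
    assert (E2 : INR (2 * c + 1) = INR (2 * n))
      by (rewrite plus_INR, !mult_INR; simpl; lra).
    apply INR_eq in E2; lia. }
  exists c; intros x.
  (* Subtracting [t e] brings [x] into the kernel of [f]. *)
  set (t := f x *k Kinv k (f e)).
  assert (E : phi (x +v (-k t) *v e) = 0k).
  { apply Hker; rewrite f1, f2; unfold t; field; exact He. }
  rewrite p1, p2, Hc in E.
  replace (phi x) with ((phi x +k -k t *k (natK c *k f e)) +k t *k (natK c *k f e)) by ring.
  rewrite E; unfold t; field; exact He.
Qed.


(** * Hahn-Banach *)

(** Chosen by [epsilon] so as to be total; meaningful only for nonempty sets bounded below. *)
Definition infimum (E : R -> Prop) : R :=
  epsilon (inhabits 0)
    (fun m => (forall r, E r -> m <= r) /\ forall b, (forall r, E r -> b <= r) -> b <= m).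

Lemma infimum_spec (E : R -> Prop) (b : R) :
  (exists r, E r) -> (forall r, E r -> b <= r) ->
  (forall r, E r -> infimum E <= r) /\
  forall b', (forall r, E r -> b' <= r) -> b' <= infimum E.
Proof.
  intros [r0 Hr0] Hb; unfold infimum; apply epsilon_spec.
  destruct (completeness (fun s => E (- s))) as [m [Hub Hlub]].
  - exists (- b); intros s Hs; specialize (Hb _ Hs); lra.
  - exists (- r0); rewrite Ropp_involutive; exact Hr0.
  - exists (- m); split.
    + intros r Hr; assert (- r <= m); [| lra].
      apply Hub; rewrite Ropp_involutive; exact Hr.
    + intros b' Hb'; assert (m <= - b'); [| lra].
      apply Hlub; intros s Hs; specialize (Hb' _ Hs); lra.
Qed.

(** Homogeneity is only an inequality for positive [t], which is easy to check for an infimum;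
    applying it to [/ t] recovers equality in [sublinear_scal]. *)
Definition sublinear (q : X -> R) : Prop :=
  (forall x y, q (x +v y) <= q x + q y) /\
  (forall t x, 0 < t -> q (ofR k t *v x) <= t * q x).

Lemma sublinear0 (q : X -> R) : sublinear q -> q (vzero X) = 0.
Proof.
  intros [H1 H2].
  assert (A := H1 (vzero X) (vzero X)); rewrite vadd0 in A.
  assert (B := H2 (1 / 2) (vzero X) ltac:(lra)).
  rewrite <- (vscal0 (vzero X)), vscalA in B at 1.
  replace (ofR k (1 / 2) *k 0k) with 0k in B by ring.
  rewrite vscal0 in B; lra.
Qed.

Lemma sublinear_opp (q : X -> R) (x : X) : sublinear q -> 0 <= q x + q (vopp x).
Proof.
  intros H; rewrite <- (sublinear0 q H), <- (vaddN _ x); apply (proj1 H).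
Qed.

Lemma sublinear_scal (q : X -> R) (t : R) (x : X) :
  sublinear q -> 0 <= t -> q (ofR k t *v x) = t * q x.
Proof.
  intros Hq Ht; destruct (Rle_lt_or_eq_dec _ _ Ht) as [Hp | <-].
  - apply Rle_antisym; [apply (proj2 Hq); exact Hp |].
    assert (H := proj2 Hq (/ t) (ofR k t *v x) (Rinv_0_lt_compat _ Hp)).
    rewrite vscalA, <- ofR_mul, Rinv_l, ofR1, vscal1 in H by lra.
    apply (Rmult_le_compat_l t) in H; [| lra].
    rewrite <- Rmult_assoc, Rinv_r, Rmult_1_l in H by lra; exact H.
  - rewrite ofR0, vscal0, sublinear0 by assumption; ring.
Qed.

(** The largest sublinear functional below [q] with value at most [- q a] at [vopp a]: any such [r]
    satisfies [r x <= r (x + t a) + t r (- a) <= q (x + t a) - t q a]. *)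
Definition tilt (q : X -> R) (a x : X) : R :=
  infimum (fun r => exists t, 0 <= t /\ r = q (x +v ofR k t *v a) - t * q a).

Lemma tilt_spec (q : X -> R) (a x : X) : sublinear q ->
  (forall t, 0 <= t -> tilt q a x <= q (x +v ofR k t *v a) - t * q a) /\
  (forall b, (forall t, 0 <= t -> b <= q (x +v ofR k t *v a) - t * q a) ->
     b <= tilt q a x).
Proof.
  intros Hq.
  destruct (infimum_spec
    (fun r => exists t, 0 <= t /\ r = q (x +v ofR k t *v a) - t * q a)
    (* Lower bound from [t q a = q (t a) <= q (x + t a) + q (- x)]. *)
    (- q (vopp x))) as [H1 H2].
  - eexists; exists 0; split; [lra | reflexivity].
  - intros r [t [Ht ->]].
    assert (H := proj1 Hq (x +v ofR k t *v a) (vopp x)).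
    rewrite (vaddC _ (x +v _)), vaddA, (vaddC _ (vopp x)), vaddN, vaddC, vadd0 in H.
    rewrite (sublinear_scal q t a Hq Ht) in H; lra.
  - split.
    + intros t Ht; apply H1; exists t; auto.
    + intros b Hb; apply H2; intros r [t [Ht ->]]; auto.
Qed.

Lemma tilt_sublinear (q : X -> R) (a : X) : sublinear q -> sublinear (tilt q a).
Proof.
  intros Hq; split.
  - intros x y.
    destruct (tilt_spec q a x Hq) as [_ Gx]; destruct (tilt_spec q a y Hq) as [_ Gy].
    destruct (tilt_spec q a (x +v y) Hq) as [L _].
    assert (tilt q a (x +v y) - tilt q a y <= tilt q a x); [| lra].
    apply Gx; intros s Hs.
    assert (tilt q a (x +v y) - (q (x +v ofR k s *v a) - s * q a) <= tilt q a y); [| lra].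
    apply Gy; intros t Ht.
    (* Parameters [s] for [x] and [t] for [y] combine into [s + t] for the sum. *)
    assert (H := L (s + t) ltac:(lra)).
    rewrite ofR_add, vscalDl, vaddACA in H.
    assert (H' := proj1 Hq (x +v ofR k s *v a) (y +v ofR k t *v a)); lra.
  - intros l x Hl.
    destruct (tilt_spec q a x Hq) as [_ G].
    destruct (tilt_spec q a (ofR k l *v x) Hq) as [L _].
    assert (H : / l * tilt q a (ofR k l *v x) <= tilt q a x).
    { apply G; intros t Ht.
      assert (H := L (l * t) (Rmult_le_pos _ _ (Rlt_le _ _ Hl) Ht)).
      rewrite ofR_mul, <- vscalA, <- vscalDr in H.
      rewrite (sublinear_scal q l _ Hq) in H by lra.
      apply (Rmult_le_compat_l (/ l)) in H; [| left; apply Rinv_0_lt_compat; exact Hl].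
      eapply Rle_trans; [exact H | right; field; lra]. }
    apply (Rmult_le_compat_l l) in H; [| lra].
    rewrite <- Rmult_assoc, Rinv_r, Rmult_1_l in H by lra; exact H.
Qed.

Lemma tilt_le (q : X -> R) (a x : X) : sublinear q -> tilt q a x <= q x.
Proof.
  intros Hq; assert (H := proj1 (tilt_spec q a x Hq) 0 (Rle_refl 0)).
  rewrite ofR0, vscal0, vadd0 in H; lra.
Qed.

Lemma tilt_opp (q : X -> R) (a : X) : sublinear q -> tilt q a (vopp a) <= - q a.
Proof.
  intros Hq; assert (H := proj1 (tilt_spec q a (vopp a) Hq) 1 Rle_0_1).
  rewrite ofR1, vscal1, vaddC, vaddN, (sublinear0 q Hq) in H; lra.
Qed.

(** The pointwise infimum works, being bounded below by [- p (- x)]. Its subadditivity needs the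
    chain: of two members tested at [x] and at [y], the smaller one serves at both points. *)
Lemma sublinear_chain_inf (A : (X -> R) -> Prop) (p : X -> R) :
  (exists q, A q) -> (forall q, A q -> sublinear q /\ forall x, q x <= p x) ->
  (forall q r, A q -> A r -> (forall x, q x <= r x) \/ (forall x, r x <= q x)) ->
  exists m, sublinear m /\ forall q, A q -> forall x, m x <= q x.
Proof.
  intros [q0 Hq0] HA Hch.
  set (m := fun x => infimum (fun r => exists q, A q /\ r = q x)).
  assert (Hm : forall x, (forall q, A q -> m x <= q x) /\
                forall b, (forall q, A q -> b <= q x) -> b <= m x).
  { intros x.
    destruct (infimum_spec (fun r => exists q, A q /\ r = q x) (- p (vopp x)))
      as [H1 H2].
    - exists (q0 x), q0; auto.
    - intros r [q [Aq ->]]; destruct (HA q Aq) as [Hs Hle].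
      assert (E := sublinear_opp q x Hs); specialize (Hle (vopp x)); lra.
    - split.
      + intros q Aq; apply H1; exists q; auto.
      + intros b Hb; apply H2; intros r [q [Aq ->]]; auto. }
  exists m; split; [split |].
  - intros x y.
    assert (m (x +v y) - m y <= m x); [| lra].
    apply (proj2 (Hm x)); intros q Aq.
    assert (m (x +v y) - q x <= m y); [| lra].
    apply (proj2 (Hm y)); intros r Ar.
    destruct (Hch q r Aq Ar) as [H|H].
    + assert (E := proj1 (Hm (x +v y)) q Aq).
      assert (E' := proj1 (proj1 (HA q Aq)) x y); specialize (H y); lra.
    + assert (E := proj1 (Hm (x +v y)) r Ar).
      assert (E' := proj1 (proj1 (HA r Ar)) x y); specialize (H x); lra.
  - intros t x Ht.
    assert (H : / t * m (ofR k t *v x) <= m x).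
    { apply (proj2 (Hm x)); intros q Aq.
      assert (E := proj1 (Hm (ofR k t *v x)) q Aq).
      rewrite (sublinear_scal q t x (proj1 (HA q Aq))) in E by lra.
      apply (Rmult_le_compat_l (/ t)) in E; [| left; apply Rinv_0_lt_compat; exact Ht].
      eapply Rle_trans; [exact E | right; field; lra]. }
    apply (Rmult_le_compat_l t) in H; [| lra].
    rewrite <- Rmult_assoc, Rinv_r, Rmult_1_l in H by lra; exact H.
  - intros q Aq x; apply (proj1 (Hm x)); exact Aq.
Qed.

(** Zorn's lemma on the sublinear functionals below [p], with chains bounded by
    [sublinear_chain_inf]. *)
Lemma minimal_sublinear (p : X -> R) : sublinear p ->
  exists q, sublinear q /\ (forall x, q x <= p x) /\
    forall r, sublinear r -> (forall x, r x <= q x) -> forall x, q x <= r x.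
Proof.
  intros Hp.
  set (S := {q : X -> R | sublinear q /\ forall x, q x <= p x}).
  (* The order is reversed, so that a maximal element is a minimal functional. *)
  set (above := fun q r : S => boolp.asbool (forall x, proj1_sig r x <= proj1_sig q x)).
  destruct (@classical_sets.ZL_preorder S
              (exist _ p (conj Hp (fun x => Rle_refl (p x)))) above)
    as [[q [Hq Hqp]] Hmin].
  - intros q; apply boolp.asboolT; intros x; apply Rle_refl.
  - intros q r s H1 H2; apply boolp.asboolT; intros x.
    apply boolp.asboolW in H1; apply boolp.asboolW in H2.
    eapply Rle_trans; [apply H2 | apply H1].
  - intros A HA.
    destruct (classic (exists q, A q)) as [[q0 Hq0]|Hne].
    2: { exists (exist _ p (conj Hp (fun x => Rle_refl (p x)))).
         intros q Aq; exfalso; apply Hne; exists q; exact Aq. }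
    destruct (sublinear_chain_inf (fun q => exists s : S, A s /\ q = proj1_sig s) p)
      as [m [Hm1 Hm2]].
    + exists (proj1_sig q0), q0; auto.
    + intros q [s [_ ->]]; exact (proj2_sig s).
    + intros q r [s [As ->]] [t [At ->]].
      destruct (HA s t As At) as [H|H]; apply boolp.asboolW in H; auto.
    + assert (Hmp : forall x, m x <= p x).
      { intros x; eapply Rle_trans;
          [apply (Hm2 (proj1_sig q0)); exists q0; auto | apply (proj2_sig q0)]. }
      exists (exist _ m (conj Hm1 Hmp)); intros s As.
      apply boolp.asboolT; intros x; apply Hm2; exists s; auto.
  - exists q; split; [exact Hq |]; split; [exact Hqp |].
    intros r Hr Hrq.
    assert (Hrp : forall x, r x <= p x) by (intros x; eapply Rle_trans; auto).
    apply (boolp.asboolW (Hmin (exist _ r (conj Hr Hrp)) (boolp.asboolT Hrq))).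
Qed.

(* A minimal sublinear functional [q] equals all its tilts, hence is odd. *)
Lemma hahn_banach_real (p : X -> R) (x0 : X) : sublinear p ->
  exists q, (forall x y, q (x +v y) = q x + q y) /\
    (forall t x, q (ofR k t *v x) = t * q x) /\
    (forall x, q x <= p x) /\ p x0 <= q x0.
Proof.
  intros Hp.
  (* Starting below [tilt p x0] instead of [p] forces [q (- x0) <= - p x0], which becomes
     [p x0 <= q x0] once [q] is odd. *)
  destruct (minimal_sublinear (tilt p x0) (tilt_sublinear p x0 Hp))
    as [q [Hq [Hqp Hmin]]].
  assert (Hodd : forall a, q (vopp a) = - q a).
  { intros a.
    assert (H1 := Hmin (tilt q a) (tilt_sublinear q a Hq) (fun x => tilt_le q a x Hq)
                    (vopp a)).
    assert (H2 := tilt_opp q a Hq); assert (H3 := sublinear_opp q a Hq); lra. }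
  assert (Hadd : forall x y, q (x +v y) = q x + q y).
  { intros x y; apply Rle_antisym; [apply (proj1 Hq) |].
    assert (H := proj1 Hq (vopp x) (vopp y)).
    replace (vopp x +v vopp y) with (vopp (x +v y)) in H
      by (rewrite !vopp_scal; apply vscalDr).
    rewrite !Hodd in H; lra. }
  exists q; split; [exact Hadd |]; split; [|split].
  - intros t x; destruct (Rle_dec 0 t) as [Ht|Ht].
    + apply sublinear_scal; assumption.
    + assert (E : q (ofR k (- t) *v x) = - t * q x)
        by (apply sublinear_scal; [exact Hq | lra]).
      assert (E2 : q (ofR k t *v x) + q (ofR k (- t) *v x) = 0); [| lra].
      rewrite <- Hadd, <- vscalDl, <- ofR_add, Rplus_opp_r, ofR0, vscal0.
      apply sublinear0; exact Hq.
  - intros x; eapply Rle_trans; [apply Hqp | apply tilt_le; exact Hp].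
  - assert (H1 := Hqp (vopp x0)); assert (H2 := tilt_opp p x0 Hp).
    rewrite Hodd in H1; lra.
Qed.

(* Hahn-Banach for the distance to [P], which is a seminorm vanishing on [P]. *)
Lemma separation (P : X -> Prop) (x0 : X) (eps : R) :
  (exists p, P p) -> (forall x y, P x -> P y -> P (x +v y)) ->
  (forall a x, P x -> P (a *v x)) ->
  0 < eps -> (forall y, P y -> eps <= vnorm (vsub x0 y)) ->
  exists f : X -> K, bounded_functional f /\ f x0 <> 0k /\ forall y, P y -> f y = 0k.
Proof.
  intros [p0 Hp0] Padd Pscal Heps Hfar.
  (* As [P] is closed under scalars, [x + y] may replace [x - y] in the distance. *)
  set (dist := fun x => infimum (fun r => exists y, P y /\ r = vnorm (x +v y))).
  assert (Hd : forall x, (forall y, P y -> dist x <= vnorm (x +v y)) /\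
                forall b, (forall y, P y -> b <= vnorm (x +v y)) -> b <= dist x).
  { intros x.
    destruct (infimum_spec (fun r => exists y, P y /\ r = vnorm (x +v y)) 0)
      as [H1 H2].
    - eexists; exists p0; split; [exact Hp0 | reflexivity].
    - intros r [y [_ ->]]; apply vnorm_ge0.
    - split.
      + intros y Py; apply H1; exists y; auto.
      + intros b Hb; apply H2; intros r [y [Py ->]]; auto. }
  assert (P0 : P (vzero X)) by (rewrite <- (vscal0 p0); apply Pscal, Hp0).
  assert (Hsub : sublinear dist).
  { split.
    - intros x y.
      assert (dist (x +v y) - dist y <= dist x); [| lra].
      apply (proj2 (Hd x)); intros a Pa.
      assert (dist (x +v y) - vnorm (x +v a) <= dist y); [| lra].
      apply (proj2 (Hd y)); intros b Pb.
      assert (H := proj1 (Hd (x +v y)) _ (Padd a b Pa Pb)).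
      rewrite vaddACA in H.
      assert (H' := vnorm_triangle _ (x +v a) (y +v b)); lra.
    - intros t x Ht.
      assert (H : / t * dist (ofR k t *v x) <= dist x).
      { apply (proj2 (Hd x)); intros y Py.
        assert (E := proj1 (Hd (ofR k t *v x)) _ (Pscal (ofR k t) y Py)).
        rewrite <- vscalDr, vnormZ, abs_ofR, Rabs_pos_eq in E by lra.
        apply (Rmult_le_compat_l (/ t)) in E; [| left; apply Rinv_0_lt_compat; exact Ht].
        eapply Rle_trans; [exact E | right; field; lra]. }
      apply (Rmult_le_compat_l t) in H; [| lra].
      rewrite <- Rmult_assoc, Rinv_r, Rmult_1_l in H by lra; exact H. }
  destruct (hahn_banach_real dist x0 Hsub) as [q [Hadd [Hscal [Hle Hx0]]]].
  assert (Hopp : forall x, q (vopp x) = - q x).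
  { intros x; rewrite vopp_scal.
    replace (-k 1k) with (ofR k (- 1)); [rewrite Hscal; ring |].
    replace (ofR k (- 1)) with ((ofR k (- 1) +k ofR k 1) +k -k 1k)
      by (rewrite ofR1; ring).
    rewrite <- ofR_add; replace (- 1 + 1) with 0 by ring; rewrite ofR0; ring. }
  assert (Hnorm : forall x, dist x <= vnorm x).
  { intros x; rewrite <- (vadd0 _ x) at 2; apply Hd, P0. }
  destruct (@scalar_extension k X q Hadd Hscal) as [f [Hf [Hf0 HfP]]].
  { intros x; apply Rabs_le; split.
    - assert (H1 := Hle (vopp x)); assert (H2 := Hnorm (vopp x)).
      rewrite Hopp in H1; rewrite vnorm_opp in H2; lra.
    - eapply Rle_trans; [apply Hle | apply Hnorm]. }
  exists f; split; [exact Hf |]; split.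
  - intros E; apply Hf0 in E.
    assert (eps <= dist x0); [| lra].
    apply (proj2 (Hd x0)); intros y Py.
    replace (x0 +v y) with (vsub x0 ((-k 1k) *v y)); [apply Hfar, Pscal, Py |].
    unfold vsub; rewrite vopp_scal, vscalA.
    replace (-k 1k *k -k 1k) with 1k by ring; rewrite vscal1; reflexivity.
  (* On [P], [q <= dist <= 0]; at [a y] and at its opposite this gives [q (a y) = 0] for every
     scalar [a], which is what makes [f y] vanish. *)
  - assert (HqP : forall y, P y -> q y <= 0).
    { intros y Py; eapply Rle_trans; [apply Hle |].
      eapply Rle_trans; [apply (proj1 (Hd y) _ (Pscal (-k 1k) y Py)) |].
      rewrite <- vopp_scal, vaddN, vnorm0; lra. }
    intros y Py; apply HfP; intros a.
    assert (H1 := HqP _ (Pscal a y Py)).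
    assert (H2 := HqP _ (Pscal (-k 1k) _ (Pscal a y Py))).
    rewrite <- vopp_scal, Hopp in H2; lra.
Qed.

(** The case of the zero subspace, at distance [vnorm x0] from [x0]. *)
Lemma separation_point (x0 : X) : x0 <> vzero X ->
  exists f : X -> K, bounded_functional f /\ f x0 <> 0k.
Proof.
  intros Hx.
  destruct (separation (fun y => y = vzero X) x0 (vnorm x0)) as [f [Hf [Hf0 _]]].
  - exists (vzero X); reflexivity.
  - intros x y -> ->; apply vadd0.
  - intros a x ->; rewrite <- (vscal0 (vzero X)), vscalA; f_equal; ring.
  - destruct (vnorm_ge0 _ x0) as [H|H]; [exact H |].
    exfalso; apply Hx, vnorm_eq0; auto.
  - intros y ->; rewrite <- (vsub_add x0 (vzero X)) at 1; rewrite vadd0; apply Rle_refl.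
  - exists f; auto.
Qed.

(** * Weakly supercyclic vectors *)

(** Padding with zero coefficients brings two combinations to a common length, so that [lsum_add]
    shows the span closed under addition. *)
Lemma lsum_pad (a : nat -> K) (v : nat -> X) (N N' : nat) : (N <= N')%nat ->
  lsum (fun n => (if Nat.leb n N then a n else 0k) *v v n) N' =
  lsum (fun n => a n *v v n) N.
Proof.
  induction 1 as [|N' HN IH].
  - assert (H : forall j, (j <= N)%nat ->
      lsum (fun n => (if Nat.leb n N then a n else 0k) *v v n) j =
      lsum (fun n => a n *v v n) j); [| apply H; lia].
    induction j as [|j IH]; intros Hj; cbn [lsum].
    + reflexivity.
    + rewrite IH by lia; replace (Nat.leb (S j) N) with true; [reflexivity |].
      symmetry; apply Nat.leb_le; lia.
  - cbn [lsum]; rewrite IH.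
    replace (Nat.leb (S N') N) with false; [rewrite vscal0; apply vadd0 |].
    symmetry; apply Nat.leb_gt; lia.
Qed.

Lemma lsum_add (a b : nat -> K) (v : nat -> X) (N : nat) :
  lsum (fun n => a n *v v n) N +v lsum (fun n => b n *v v n) N =
  lsum (fun n => (a n +k b n) *v v n) N.
Proof.
  induction N as [|N IH]; simpl; rewrite vscalDl; [reflexivity |].
  rewrite <- IH; apply vaddACA.
Qed.

Lemma lsum_scal (c : K) (a : nat -> K) (v : nat -> X) (N : nat) :
  c *v lsum (fun n => a n *v v n) N = lsum (fun n => (c *k a n) *v v n) N.
Proof.
  induction N as [|N IH]; simpl; rewrite ?vscalDr, ?IH, vscalA; reflexivity.
Qed.

(** Places the points of the projective orbit in the span used by [cyclic_vector]. *)
Lemma lsum_single (v : nat -> X) (z : K) (m : nat) :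
  lsum (fun n => (if Nat.eqb n m then z else 0k) *v v n) m = z *v v m.
Proof.
  assert (H : forall j, (j < m)%nat ->
    lsum (fun n => (if Nat.eqb n m then z else 0k) *v v n) j = vzero X).
  { induction j as [|j IH]; intros Hj; cbn [lsum].
    - replace (Nat.eqb 0 m) with false; [apply vscal0 |].
      symmetry; apply Nat.eqb_neq; lia.
    - rewrite IH by lia; replace (Nat.eqb (S j) m) with false.
      + rewrite vscal0; apply vadd0.
      + symmetry; apply Nat.eqb_neq; lia. }
  destruct m as [|m]; [reflexivity |].
  cbn [lsum]; rewrite H by lia; rewrite Nat.eqb_refl, vaddC; apply vadd0.
Qed.

(** If the span of the orbit were not norm dense, a nonzero functional would vanish on it, hence on
    the projective orbit, which weak density rules out. *)
Lemma weakly_supercyclic_vector_cyclic (T : X -> X) (u : X) :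
  weakly_dense (proj_orbit T u) -> cyclic_vector T u.
Proof.
  intros Hu; apply NNPP; intros Hn.
  unfold cyclic_vector, dense in Hn.
  apply not_all_ex_not in Hn; destruct Hn as [x Hn].
  apply not_all_ex_not in Hn; destruct Hn as [eps Hn].
  apply imply_to_and in Hn; destruct Hn as [Heps Hn].
  set (P := fun y : X => exists (N : nat) (a : nat -> K),
              y = lsum (fun n => a n *v Nat.iter n T u) N) in Hn.
  assert (HP : forall z n, P (z *v Nat.iter n T u)).
  { intros z n; exists n, (fun j => if Nat.eqb j n then z else 0k).
    symmetry; apply (lsum_single (fun j => Nat.iter j T u)). }
  destruct (separation P x eps) as [f [Hf [Hfx HfP]]].
  - eexists; exact (HP 0k 0%nat).
  - intros y y' [N [a ->]] [N' [a' ->]].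
    exists (Nat.max N N'),
      (fun n => (if Nat.leb n N then a n else 0k) +k (if Nat.leb n N' then a' n else 0k)).
    rewrite <- (lsum_add _ _ (fun n => Nat.iter n T u)).
    rewrite !(lsum_pad _ (fun n => Nat.iter n T u)) by lia; reflexivity.
  - intros c y [N [a ->]]; exists N, (fun n => c *k a n).
    apply (lsum_scal c a (fun n => Nat.iter n T u)).
  - exact Heps.
  - intros y Py; apply Rnot_lt_le; intros H; apply Hn; exists y; auto.
  - destruct (weakly_dense_pair (proj_orbit T u) f f x _ Hu Hf Hf (abs_gt0 k _ Hfx))
      as [w [[z [n ->]] [H _]]].
    rewrite (HfP _ (HP z n)) in H.
    replace (0k +k -k f x) with (-k f x) in H by ring.
    rewrite abs_opp in H; lra.
Qed.

(** * Commutators along the orbit *)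

Lemma iter_commute (T S : X -> X) (n : nat) (x : X) :
  (forall y, T (S y) = S (T y)) -> Nat.iter n T (S x) = S (Nat.iter n T x).
Proof.
  intros H; induction n as [|n IH]; simpl; [reflexivity | rewrite IH; apply H].
Qed.

(* [T^n M - M T^n = n T^(n-1) [T, M]], multiplied by [T] to include [n = 0]. *)
Lemma iter_commutator (T M : X -> X) (n : nat) (x : X) :
  bounded_linear T -> op_zero (comm T (comm T M)) ->
  T (Nat.iter n T (M x)) =
  T (M (Nat.iter n T x)) +v natK n *v comm T M (Nat.iter n T x).
Proof.
  intros [T1 [T2 _]] HA.
  assert (HTA : forall y, T (comm T M y) = comm T M (T y))
    by (intros y; apply vsubK_eq, HA).
  induction n as [|n IH].
  - simpl; rewrite ofR0, vscal0, vadd0; reflexivity.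
  - change (Nat.iter (S n) T (M x)) with (T (Nat.iter n T (M x))); rewrite IH.
    set (y := Nat.iter n T x); change (Nat.iter (S n) T x) with (T y).
    (* Moving [M] past one more [T] costs one commutator; [HTA] brings all copies to the point
       [T y]. *)
    replace (T (M y)) with (comm T M y +v M (T y)) by apply vsub_add.
    rewrite !T1, T2, HTA, S_INR, ofR_add, vscalDl, ofR1, vscal1.
    rewrite (vaddC _ (comm T M (T y))), <- vaddA; f_equal; apply vaddC.
Qed.

(* If [f = q [T, M]] were nonzero, every functional [psi] would satisfy
   [f e * psi = psi e * f], as on a one-dimensional space, where commutators vanish. *)
Lemma commutator_functional_zero (P : X -> Prop) (T M : X -> X) (q : X -> K) (e : X) :
  weakly_dense P -> bounded_linear T -> bounded_linear M -> bounded_functional q ->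
  (forall w, P w -> q (comm T M w) <> 0k -> exists z, w = z *v e) ->
  forall x, q (comm T M x) = 0k.
Proof.
  intros HP HT HM Hq He.
  set (f := fun x => q (T (M x)) +k (-k 1k) *k q (M (T x))).
  assert (Ef : forall x, q (comm T M x) = f x).
  { intros x; unfold comm, f; rewrite bounded_functional_sub by exact Hq; ring. }
  assert (HqT := bounded_functional_comp q T Hq HT).
  assert (HqM := bounded_functional_comp q M Hq HM).
  assert (Hf : bounded_functional f).
  { apply bounded_functional_comb.
    - exact (bounded_functional_comp _ M HqT HM).
    - exact (bounded_functional_comp _ T HqM HT). }
  assert (Hrank : forall psi, bounded_functional psi ->
            forall x, f e *k psi x = psi e *k f x).
  { intros psi Hpsi.
    (* This combination vanishes at [e] by construction; the claim is that it vanishes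
       everywhere. *)
    set (psi' := fun x => f e *k psi x +k (-k psi e) *k f x).
    assert (Hpsi' : bounded_functional psi').
    { unfold psi'; destruct Hpsi as [h1 [h2 [c h3]]].
      apply (bounded_functional_comb (fun x => f e *k psi x)); [| exact Hf].
      split; [|split].
      - intros x y; rewrite h1; ring.
      - intros a x; rewrite h2; ring.
      - exists (`|f e| * c); intros x; rewrite abs_mul, Rmult_assoc.
        apply Rmult_le_compat_l; [apply abs_ge0 | apply h3]. }
    assert (He0 : forall z, psi' (z *v e) = 0k).
    { intros z; rewrite (proj1 (proj2 Hpsi')); unfold psi'; ring. }
    (* A point [w] of [P] close to [x] for both functionals has [f w <> 0], so it is a multiple of
       [e] and [psi' w = 0], too far from [psi' x]. *)
    assert (Hoff : forall x, f x <> 0k -> psi' x = 0k).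
    { intros x Hx; apply NNPP; intros Hp.
      destruct (weakly_dense_pair P f psi' x (Rmin (`|f x|) (`|psi' x|)) HP Hf Hpsi')
        as [w [Pw [H1 H2]]].
      { apply Rmin_pos; apply abs_gt0; assumption. }
      destruct (He w Pw) as [z ->].
      - rewrite Ef; intros E; rewrite E in H1.
        replace (0k +k -k f x) with (-k f x) in H1 by ring.
        rewrite abs_opp in H1; assert (H := Rmin_l (`|f x|) (`|psi' x|)); lra.
      - rewrite He0 in H2.
        replace (0k +k -k psi' x) with (-k psi' x) in H2 by ring.
        rewrite abs_opp in H2; assert (H := Rmin_r (`|f x|) (`|psi' x|)); lra. }
    assert (Hall : forall x, f e <> 0k -> psi' x = 0k).
    { intros x Hfe; destruct (classic (f x = 0k)) as [Hx|Hx]; [| auto].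
      (* Adding [e] leaves the kernel of [f] without changing [psi']. *)
      assert (E : psi' (x +v e) = 0k).
      { apply Hoff; rewrite (proj1 Hf), Hx; intros E; apply Hfe; rewrite <- E; ring. }
      rewrite (proj1 Hpsi'), <- (vscal1 _ e), He0 in E; rewrite <- E; ring. }
    intros x.
    assert (E : psi' x = 0k -> f e *k psi x = psi e *k f x).
    { intros E; replace (f e *k psi x) with (psi' x +k psi e *k f x)
        by (unfold psi'; ring); rewrite E; ring. }
    apply E; destruct (classic (f x = 0k)) as [Hx|Hx]; [| auto].
    destruct (classic (f e = 0k)) as [Hfe|Hfe]; [| auto].
    unfold psi'; rewrite Hx, Hfe; ring. }
  assert (Hfe : f e = 0k).
  { apply NNPP; intros Hne.
    assert (A1 := Hrank _ HqT (M e)); assert (A2 := Hrank _ Hq (T e)).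
    assert (B1 := Hrank _ HqM (T e)); assert (B2 := Hrank _ Hq (M e)).
    cbv beta in A1, B1.
    (* By the four relations, both terms of the expanded cube equal [q e * f (T e) * f (M e)], so
       they cancel. *)
    assert (E : f e *k (f e *k f e) = 0k).
    { unfold f at 3.
      replace (f e *k (f e *k (q (T (M e)) +k -k 1k *k q (M (T e)))))
        with (f e *k (f e *k q (T (M e))) +k -k (f e *k (f e *k q (M (T e))))) by ring.
      rewrite A1, B1.
      replace (f e *k (q (T e) *k f (M e))) with ((f e *k q (T e)) *k f (M e)) by ring.
      replace (f e *k (q (M e) *k f (T e))) with ((f e *k q (M e)) *k f (T e)) by ring.
      rewrite A2, B2; ring. }
    apply Hne.
    replace (f e) with (f e *k (f e *k f e) *k Kinv k (f e *k f e)) by (field; exact Hne).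
    rewrite E; ring. }
  intros x; rewrite Ef; apply NNPP; intros Hx.
  destruct (weakly_dense_pair P f f x _ HP Hf Hf (abs_gt0 k _ Hx)) as [w [Pw [H _]]].
  assert (Hfw : f w = 0k).
  { apply NNPP; intros Hw; destruct (He w Pw) as [z ->]; [rewrite Ef; exact Hw |].
    apply Hw; rewrite (proj1 (proj2 Hf)), Hfe; ring. }
  rewrite Hfw in H; replace (0k +k -k f x) with (-k f x) in H by ring.
  rewrite abs_opp in H; lra.
Qed.

Lemma not_weakly_supercyclic (T M : X -> X) :
  bounded_linear T -> bounded_linear M -> op_zero (comm T (comm T M)) ->
  (forall u : X, cyclic_vector T u -> forall v : X,
     exists B C : X -> X, in_commutant T B /\ in_commutant T C /\
       ~ op_zero (fun x => C (comm T M x)) /\ C v = B u) ->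
  ~ weakly_supercyclic T.
Proof.
  intros HT HM HA Hcyc [u Hu].
  (* The choice [v = M u] ties [C M u] to [B u]. *)
  destruct (Hcyc u (weakly_supercyclic_vector_cyclic T u Hu) (M u))
    as [B [C [[HB HTB] [[HC HTC] [Hne HCB]]]]].
  apply Hne; intros x0; apply NNPP; intros Hx0.
  destruct (separation_point _ Hx0) as [g [Hg Hgx]].
  set (q := fun x => g (C x)).
  assert (Hq : bounded_functional q) by exact (bounded_functional_comp g C Hg HC).
  set (f := fun x => q (comm T M x)).
  assert (Hf : bounded_functional f).
  { assert (H := bounded_functional_comb _ _ (-k 1k)
      (bounded_functional_comp _ M (bounded_functional_comp q T Hq HT) HM)
      (bounded_functional_comp _ T (bounded_functional_comp q M Hq HM) HT)).
    assert (E : forall x, f x = q (T (M x)) +k -k 1k *k q (M (T x))).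
    { intros x; unfold f, comm; rewrite bounded_functional_sub by exact Hq; ring. }
    destruct H as [h1 [h2 [c h3]]]; split; [|split].
    - intros x y; rewrite !E; apply h1.
    - intros a x; rewrite !E; apply h2.
    - exists c; intros x; rewrite E; apply h3. }
  set (phi := fun x => g (T (B x)) +k (-k 1k) *k q (T (M x))).
  assert (Hphi : bounded_functional phi).
  { apply bounded_functional_comb.
    - exact (bounded_functional_comp _ B (bounded_functional_comp g T Hg HT) HB).
    - exact (bounded_functional_comp _ M (bounded_functional_comp q T Hq HT) HM). }
  assert (Horb : forall n, phi (Nat.iter n T u) = natK n *k f (Nat.iter n T u)).
  { intros n; unfold phi.
    (* [B] moves inside to [u], [B u] becomes [C M u], and [C] moves back out to form [q]; after
       [iter_commutator] the term [q (T (M (T^n u)))] cancels. *)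
    rewrite <- (iter_commute T B n u HTB), <- HCB, (iter_commute T C n (M u) HTC), HTC.
    change (g (C (T (Nat.iter n T (M u))))) with (q (T (Nat.iter n T (M u)))).
    rewrite (iter_commutator T M n u HT HA), (proj1 Hq), (proj1 (proj2 Hq)).
    unfold f; ring. }
  destruct (weakly_dense_natural_ratio (proj_orbit T u) f phi Hu Hf Hphi) as [c Hc].
  { intros w [z [n ->]]; exists n.
    rewrite (proj1 (proj2 Hphi)), (proj1 (proj2 Hf)), Horb; ring. }
  apply Hgx; change (f x0 = 0k).
  (* Here [e] is [T^c u]: the orbit points of any other index lie in the kernel of [f]. *)
  apply (commutator_functional_zero (proj_orbit T u) T M q (Nat.iter c T u));
    try assumption.
  intros w [z [n ->]] Hw; exists z; do 2 f_equal.
  apply NNPP; intros Hnc; apply Hw; change (f (z *v Nat.iter n T u) = 0k).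
  rewrite (proj1 (proj2 Hf)).
  (* At [T^n u] both [phi = n f] and [phi = c f] hold. *)
  assert (E : ofR k (INR n - INR c) *k f (Nat.iter n T u) = 0k).
  { assert (E := Horb n); rewrite Hc in E.
    replace (ofR k (INR n - INR c)) with (natK n +k -k natK c).
    - replace ((natK n +k -k natK c) *k f (Nat.iter n T u))
        with (natK n *k f (Nat.iter n T u) +k -k (natK c *k f (Nat.iter n T u))) by ring.
      rewrite E; ring.
    - replace (natK n) with (ofR k ((INR n - INR c) + INR c)) by (f_equal; ring).
      rewrite ofR_add; ring. }
  assert (Hd : INR n - INR c <> 0) by (intros H; apply Hnc, INR_eq; lra).
  assert (Hf0 : f (Nat.iter n T u) = 0k).
  { rewrite <- (vscal1 _ (Nat.iter n T u)), <- ofR1, (proj1 (proj2 Hf)).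
    replace 1 with (/ (INR n - INR c) * (INR n - INR c)) by (field; exact Hd).
    rewrite ofR_mul.
    replace (ofR k (/ (INR n - INR c)) *k ofR k (INR n - INR c) *k f (Nat.iter n T u))
      with (ofR k (/ (INR n - INR c)) *k (ofR k (INR n - INR c) *k f (Nat.iter n T u)))
      by ring.
    rewrite E; ring. }
  rewrite Hf0; ring.
Qed.

End Space.
End Theory.

Theorem theorem1p4 (k : field_kind) (X : Banach (Kof k)) (T : X -> X)
  (HT : bounded_linear T) :
  (exists M : X -> X, bounded_linear M /\ op_zero (comm T (comm T M)) /\
     forall u : X, cyclic_vector T u -> forall v : X,
       exists B C : X -> X, in_commutant T B /\ in_commutant T C /\
         ~ op_zero (fun x => C (comm T M x)) /\ C v = B u) ->
  ~ supercyclic T /\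
  ((exists R : X -> X, in_commutant T R /\ dense_range R /\
      exists (Y : Banach (Kof k)) (j : Y -> X),
        embedding j /\ class_Y Y /\ (forall x, exists y, j y = R x)) ->
   ~ weakly_supercyclic T).
Proof.
  intros [M [HM [HA Hcyc]]].
  assert (H := not_weakly_supercyclic T M HT HM HA Hcyc).
  split; [| intros _; exact H].
  (* A norm dense projective orbit is weakly dense, so the norm case follows from the weak one. *)
  intros [u Hu]; apply H; exists u; apply dense_weakly_dense; exact Hu.
Qed.
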